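(* Let $L$ be a rigid group and let $G \cong L^\omega$. Then the following hold. (a) $\operatorname{Aut} G = \operatorname{Inn} G \rtimes S_\omega$, where, identifying $G$ with $L^\omega$, the group $S_\omega$ is regarded as the subgroup of $\operatorname{Aut} G$ consisting of the automorphisms that permute the coordinates, $(x_n)_{n\in\omega} \mapsto (x_{\pi(n)})_{n\in\omega}$ with $\pi \in S_\omega$. (b) $G$ is a splitter. (c) $G \times G \cong G$.
   Context: $\omega=\{0,1,2,\ldots\}$, and $S_\omega$ is the full symmetric group of all permutations of $\omega$. For a group $A$ and a cardinal $\kappa$, $A^\kappa$ is the (full, unrestricted) cartesian power of $\kappa$ copies of $A$. $\operatorname{Aut} A$ and $\operatorname{Inn} A$ are the groups of automorphisms and of inner automorphisms of $A$; $\operatorname{Hom}(A,B)$ is the set of group homomorphisms $A \to B$; $\operatorname{End} A = \operatorname{Hom}(A,A)$; $0$ denotes the trivial homomorphism sending every element to $1$, and $\operatorname{Hom}(A,B)=0$ means that the trivial homomorphism is the only one. $N \rtimes U$ denotes an (internal) semidirect product with $N$ normal; $N\times U$ a direct product. A group $L \neq 1$ is called rigid if: (i) $L$ is complete, i.e. $L$ has trivial center and $\operatorname{Aut} L = \operatorname{Inn} L$; (ii) $\operatorname{Hom}(L^\omega, S_\omega) = 0$; (iii) $\operatorname{End} L = \operatorname{Inn} L \cup \{0\}$. A group $G$ is called a splitter if every short exact sequence of groups $1 \to G \to H \xrightarrow{\alpha} G \to 1$ admits a splitting homomorphism $\gamma: G \to H$ (i.e. $\alpha\circ\gamma = \mathrm{id}_G$)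 whose image is normal in $H$. Equivalently: whenever $H$ is a group with $G \triangleleft H$ and $H/G \cong G$, then $H = G \times N$ for some normal subgroup $N \triangleleft H$ with $N \cong G$. *)

(* Defs.v *)
From HB Require Import structures.
From mathcomp Require Import all_boot.
From mathcomp Require Import boolp classical_sets.

Set Implicit Arguments.
Unset Strict Implicit.
Unset Printing Implicit Defensive.

Local Open Scope group_scope.
Local Open Scope classical_set_scope.

(* Unrestricted cartesian power, with pointwise operations; the full power     *)
(* A^omega is nat -> A.                                                       *)
Section Power.
Variables (I : Type) (A : groupType).
Implicit Types x y z : I -> A.

Definition pow_one : I -> A := fun=> 1.
Definition pow_inv x : I -> A := fun i => (x i)^-1.
Definition pow_mul x y : I -> A := fun i => x i * y i.

Lemma pow_mulA : associative pow_mul.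
Proof. by move=> x y z; apply/funext => i; exact: mulgA. Qed.
Lemma pow_mul1 : left_id pow_one pow_mul.
Proof. by move=> x; apply/funext => i; exact: mul1g. Qed.
Lemma pow_mulr1 : right_id pow_one pow_mul.
Proof. by move=> x; apply/funext => i; exact: mulg1. Qed.
Lemma pow_mulV : left_inverse pow_one pow_inv pow_mul.
Proof. by move=> x; apply/funext => i; exact: mulVg. Qed.
Lemma pow_mulrV : right_inverse pow_one pow_inv pow_mul.
Proof. by move=> x; apply/funext => i; exact: mulgV. Qed.

HB.instance Definition _ := isGroup.Build (I -> A)
  pow_mulA pow_mul1 pow_mulr1 pow_mulV pow_mulrV.

End Power.

(* The full symmetric group on T, with (p * q) x = p (q x); S_omega is         *)
(* symm nat. MathComp's {perm T} is restricted to finite T.                   *)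
Record symm (T : Type) := Symm {
  symm_fun :> T -> T;
  symm_inv : T -> T;
  symm_funK : cancel symm_fun symm_inv;
  symm_invK : cancel symm_inv symm_fun
}.

HB.instance Definition _ (T : Type) := gen_eqMixin (symm T).
HB.instance Definition _ (T : Type) := gen_choiceMixin (symm T).

Section SymmetricGroup.
Variable T : Type.
Implicit Types p q r : symm T.

Lemma symmP p q : p =1 q -> p = q.
Proof.
case: p q => [f f' fK f'K] [g g' gK g'K] /= /funext eq_fg; subst g.
have eq_f'g' : f' = g' by apply/funext => x; rewrite -[x in LHS]g'K fK.
by subst g'; congr Symm; apply: Prop_irrelevance.
Qed.

Definition symm1 : symm T := @Symm T id id (fun=> erefl) (fun=> erefl).
Definition symmV p : symm T := Symm (@symm_invK T p) (@symm_funK T p).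
Definition symmM p q : symm T :=
  Symm (can_comp (@symm_funK T p) (@symm_funK T q))
       (can_comp (@symm_invK T q) (@symm_invK T p)).

Lemma symm_mulA : associative symmM.
Proof. by move=> p q r; apply: symmP. Qed.
Lemma symm_mul1 : left_id symm1 symmM.
Proof. by move=> p; apply: symmP. Qed.
Lemma symm_mulr1 : right_id symm1 symmM.
Proof. by move=> p; apply: symmP. Qed.
Lemma symm_mulV : left_inverse symm1 symmV symmM.
Proof. by move=> p; apply: symmP => x /=; rewrite symm_funK. Qed.
Lemma symm_mulrV : right_inverse symm1 symmV symmM.
Proof. by move=> p; apply: symmP => x /=; rewrite symm_invK. Qed.

HB.instance Definition _ := isGroup.Build (symm T)
  symm_mulA symm_mul1 symm_mulr1 symm_mulV symm_mulrV.

End SymmetricGroup.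

Section Subgroups.
Variable A : groupType.
Implicit Types S N U : set A.

Definition subgroup S := S 1 /\ forall x y, S x -> S y -> S (x / y).

Definition normal_in N S :=
  [/\ subgroup N, N `<=` S & forall x y, N x -> S y -> N (x ^ y)].

(* Internal semidirect product S = N >< U. *)
Definition semidirect N U S :=
  [/\ subgroup S, normal_in N S, subgroup U, N `&` U = [set 1]
    & [set x * y | x in N & y in U] = S].

Definition center : set A := [set z | forall x, commute z x].

End Subgroups.
Arguments center A : clear implicits.

Definition Hom (A B : groupType) : set (A -> B) :=
  [set f | monoid_morphism f].
Arguments Hom A B : clear implicits.

Definition trivial_hom (A B : groupType) : A -> B := fun=> 1.
Arguments trivial_hom A B : clear implicits.

Definition isomorphism (A B : groupType) (f : A -> B) :=
  Hom A B f /\ bijective f.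

Definition isomorphic (A B : groupType) :=
  exists f : A -> B, isomorphism f.

(* Aut A and Inn A are subgroups of the symmetric group on A, so that they     *)
(* carry the composition of maps as group law.                                *)
Definition Aut (A : groupType) : set (symm A) := [set a : symm A | Hom A A a].
Arguments Aut A : clear implicits.

Definition Inn (A : groupType) : set (symm A) :=
  [set a : symm A | exists g : A, forall x : A, a x = x ^ g].
Arguments Inn A : clear implicits.

Definition complete (A : groupType) :=
  center A = [set 1] /\ Aut A = Inn A.

Definition rigid (L : groupType) :=
  [/\ exists x : L, x <> 1,
      complete L,
      Hom (nat -> L) (symm nat) = [set trivial_hom (nat -> L) (symm nat)]
    & Hom L L = [set symm_fun a | a in Inn L] `|` [set trivial_hom L L]].

Definition short_exact (A H B : groupType) (i : A -> H) (p : H -> B) :=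
  [/\ Hom A H i, Hom H B p, injective i, range p = setT
    & range i = [set h | p h = 1]].

Definition splitter (G : groupType) :=
  forall (H : groupType) (i : G -> H) (p : H -> G), short_exact i p ->
  exists c : G -> H,
    [/\ Hom G H c, cancel c p & normal_in (range c) [set: H]].

(* The permutation a of G becomes (x_n) |-> (x_(s n)) when G is identified     *)
(* with L^omega along phi.                                                    *)
Definition permutes_coords (G L : groupType) (phi : G -> nat -> L)
    (a : symm G) (s : symm nat) :=
  forall (x : G) (n : nat), phi (a x) n = phi x (s n).

Definition coord_perms (G L : groupType) (phi : G -> nat -> L) :
    set (symm G) :=
  [set a : symm G | exists s, permutes_coords phi a s].

(* Main.v *)
(* View an automorphism of L^omega as an infinite matrix of endomorphisms of L, *)
(* each of them inner or trivial by rigidity. The entries in a row have         *)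
(* commuting images and L has trivial center, so each row, and by bijectivity   *)
(* each column, has exactly one inner entry: the automorphism permutes the      *)
(* coordinates and conjugates in each of them, which is (a). Hence              *)
(* Out G = S_omega, and an extension H of G by G acts on G by conjugation       *)
(* through H -> H/G = L^omega -> S_omega, which is trivial modulo Inn G; thus   *)
(* H is the product of G and its centralizer, which is (b).                     *)
Require Import Defs.
From mathcomp Require Import all_boot.
From mathcomp Require Import boolp classical_sets.

Local Open Scope group_scope.
Local Open Scope classical_set_scope.

(** The matrix argument is [power_automorphism_coords]. Through it each automorphism of $G$ acquires
    a unique permutation of the coordinates ([Aut_twists], [twists_uniq]). This assignment reverses
    products, its kernel is [Inn G] ([twists1_inner]), and [coord_perm] provides a complement of
    that kernel, whence (a). In an extension, conjugation by elements of $H$ reverses products as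
    well, so $H$ maps homomorphically to $S_\omega$; since $G$ goes to 1, condition (ii) makes this
    map trivial. All these conjugations are then inner on $G$, and [splitter_of_inner_extensions]
    applies. Part (c) splits $\omega$ into even and odd numbers. *)

Lemma HomV (A B : groupType) (f : A -> B) x : Hom A B f -> f x^-1 = (f x)^-1.
Proof.
by move=> [f1 fM]; apply: (mulgI (f x)); rewrite -fM !mulgV.
Qed.

Lemma HomJ (A B : groupType) (f : A -> B) x y :
  Hom A B f -> f (x ^ y) = f x ^ f y.
Proof. by move=> fH; rewrite !conjgE !fH.2 HomV. Qed.

Lemma Hom_can (A B : groupType) (f : A -> B) (g : B -> A) :
  Hom A B f -> cancel f g -> cancel g f -> Hom B A g.
Proof.
move=> fH fK gK; split=> [|x y]; first by rewrite -fH.1 fK.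
by rewrite -{1}(gK x) -{1}(gK y) -fH.2 fK.
Qed.

Lemma subgroup_range (A B : groupType) (f : A -> B) :
  Hom A B f -> subgroup (range f).
Proof.
move=> fH; split; first by exists 1; rewrite ?fH.1.
by move=> _ _ [x _ <-] [y _ <-]; exists (x / y); rewrite // fH.2 HomV.
Qed.

Lemma subgroupM (A : groupType) (S : set A) x y :
  subgroup S -> S x -> S y -> S (x * y).
Proof.
move=> [S1 SV] Sx Sy; rewrite -[y]invgK; apply: (SV) => //.
by rewrite -div1g; apply: SV.
Qed.

Lemma Aut_subgroup (G : groupType) : subgroup (Aut G).
Proof.
split=> [|a b aH bH]; first by split.
have bVH := Hom_can _ _ _ _ bH (symm_funK b) (symm_invK b).
split=> [|x y] /=; first by rewrite bVH.1 aH.1.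
by rewrite bVH.2 aH.2.
Qed.

Definition conj_symm {G : groupType} (g : G) : symm G :=
  Symm (conjgK g) (conjgKV g).

Lemma Inn_normal (G : groupType) : normal_in (Inn G) (Aut G).
Proof.
split.
- split=> [|a b [g ga] [h hb]]; first by exists 1 => x; rewrite conjg1.
  (* The quotient applies the inverse of [b] first, and conjugators multiply in order of
     application. *)
  exists (h^-1 * g) => x; rewrite conjgM -ga; congr (a _).
  by apply: (can_inj (symm_funK b)); rewrite symm_invK hb conjgKV.
- move=> a [g ga]; split=> [|x y]; first by rewrite ga conj1g.
  by rewrite !ga conjMg.
- move=> a b [g ga] bH; exists (symm_inv b g) => x.
  have bVH := Hom_can _ _ _ _ bH (symm_funK b) (symm_invK b).
  change (symm_inv b (a (b x)) = x ^ symm_inv b g).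
  by rewrite ga (HomJ _ _ _ _ _ bVH) symm_funK.
Qed.

(** * Extensions in which the kernel has a normal complement *)

Lemma conj_normal_sub (G H Q : groupType) (i : G -> H) (p : H -> Q) :
  short_exact i p -> forall h x, exists y, i y = i x ^ h.
Proof.
case=> iH pH _ _ ker h x.
have: range i (i x ^ h).
  rewrite ker /= (HomJ _ _ _ _ _ pH).
  have ->: p (i x) = 1.
    suff: [set z | p z = 1] (i x) by [].
    by rewrite -ker; exists x.
  by rewrite conj1g.
by case=> y _ yE; exists y.
Qed.

(* The splitting map sends x to the unique preimage of x under p that          *)
(* centralizes the kernel.                                                    *)
Lemma splitter_of_inner_extensions (G : groupType) :
  center G = [set 1] ->
  (forall (H : groupType) (i : G -> H) (p : H -> G), short_exact i p ->
     forall h, exists g, forall x, i x ^ h = i x ^ i g) ->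
  splitter G.
Proof.
move=> Z1 inner H i p ex; have [iH pH i_inj p_surj ker] := ex.
pose cent h := forall z, i z ^ h = i z.
have pi z : p (i z) = 1.
  suff: [set z | p z = 1] (i z) by [].
  by rewrite -ker; exists z.
have centV h : cent h -> cent h^-1 by move=> ch z; rewrite -{1}(ch z) conjgK.
have centM h k : cent h -> cent k -> cent (h * k).
  by move=> ch ck z; rewrite conjgM ch ck.
(* A kernel element centralizing the kernel comes from the center of [G]. *)
have cent1 h : p h = 1 -> cent h -> h = 1.
  move=> ph ch; have [z _ zE] : range i h by rewrite ker.
  suff: center G z by rewrite Z1 => /= z1; rewrite -zE z1 iH.1.
  move=> y; apply: i_inj; rewrite !iH.2 zE -{1}(ch y).
  by rewrite conjgE mulgA mulgV mul1g.
have ex_c x : exists h, p h = x /\ cent h.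
  have [h _ <-] : range p x by rewrite p_surj.
  have [g gP] := inner H i p ex h.
  (* Correct an arbitrary lift by the kernel element inducing the same conjugation. *)
  exists (h * (i g)^-1); split; first by rewrite pH.2 HomV // pi invg1 mulg1.
  by move=> z; rewrite conjgM gP conjgK.
have [c cP] := choice ex_c.
have pc x : p (c x) = x by case: (cP x).
have cent_c x : cent (c x) by case: (cP x).
have c_uniq x h : p h = x -> cent h -> c x = h.
  move=> ph ch; apply: divg1_eq; apply: cent1.
    by rewrite pH.2 HomV // pc ph mulgV.
  exact/centM/centV.
have cH : Hom G H c.
  split=> [|x y]; first by apply: c_uniq; rewrite ?pH.1 // => z; rewrite conjg1.
  by apply: c_uniq; [rewrite pH.2 !pc | exact: centM].
exists c; split => //; split=> [|//|_ h [x _ <-] _]; first exact: subgroup_range.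
exists (p (c x ^ h)) => //; apply: c_uniq => // z.
have [y yE] := conj_normal_sub _ _ _ _ _ ex h^-1 z.
have ->: i z = i y ^ h by rewrite yE conjgKV.
by rewrite -conjJg cent_c.
Qed.

(** * Automorphisms of cartesian powers *)

Section CoordinateEmbedding.
Variables (I : eqType) (L : groupType).

Definition single (i : I) (x : L) : I -> L := fun j => if j == i then x else 1.

Lemma single_id i x : single i x i = x.
Proof. by rewrite /single eqxx. Qed.

Lemma single_neq i j x : j != i -> single i x j = 1.
Proof. by rewrite /single => /negPf ->. Qed.

Lemma single1 i : single i 1 = 1.
Proof. by apply/funext => j; rewrite /single; case: ifP. Qed.

Lemma singleM i x y : single i (x * y) = single i x * single i y.
Proof.
apply/funext => j; change (single i (x * y) j = single i x j * single i y j).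
by rewrite /single; case: ifP => // _; rewrite mulg1.
Qed.

(** If [s m] and [t m] differ, the element supported at [s m] with value [x] gives a conjugate of
    [x] on the left and 1 on the right. *)
Lemma coord_map_uniq (x : L) (s t : I -> I) (g h : I -> L) : x <> 1 ->
  (forall (y : I -> L) m, y (s m) ^ g m = y (t m) ^ h m) -> s =1 t.
Proof.
move=> x1 st m; apply/eqP; apply: contra_notT x1 => nst.
have := st (single (s m) x) m; rewrite single_id single_neq 1?eq_sym //.
by move/eqP; rewrite conj1g conjg_eq1 => /eqP.
Qed.

End CoordinateEmbedding.
Arguments single {I L} i x.

(* Let E m n be the (m, n) matrix entry of f, an endomorphism of L. If E m n   *)
(* is inner, then it is onto, so the coordinates other than n contribute a    *)
(* central, hence trivial, element to the m-th coordinate of f y.             *)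
Lemma power_automorphism_coords (I : eqType) (L : groupType)
    (f : (I -> L) -> I -> L) (a : L) : a <> 1 -> center L = [set 1] ->
  (forall h, Hom L L h ->
     (exists g, forall x, h x = x ^ g) \/ h = trivial_hom L L) ->
  Hom (I -> L) (I -> L) f -> bijective f ->
  exists (s : symm I) (g : I -> L), forall y m, f y m = y (s m) ^ g m.
Proof.
move=> a1 Z1 endL fH [f' fK f'K].
have fM y z m : f (y * z) m = f y m * f z m by rewrite fH.2.
pose E m n x := f (single n x) m.
have EH m n : Hom L L (E m n).
  split=> [|x y]; first by rewrite /E single1 fH.1.
  by rewrite /E singleM fM.
have conj_neq1 g : a ^ g <> 1 by move/eqP; rewrite conjg_eq1 => /eqP.
have rowE m n g : (forall x, E m n x = x ^ g) -> forall y, f y m = y n ^ g.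
  move=> Eg y; pose y' j := if j == n then 1 else y j.
  have -> : y = single n (y n) * y'.
    apply/funext => j; change (y j = single n (y n) j * y' j).
    by rewrite /single /y'; case: eqP => [->|_]; rewrite ?mulg1 ?mul1g.
  rewrite fM -/(E m n _) Eg -[RHS]mulg1; congr (_ * _).
    by congr (_ ^ _); change (y n = single n (y n) n * y' n);
       rewrite /y' single_id eqxx mulg1.
  suff: center L (f y' m) by rewrite Z1.
  (* Every [x] is a value of the inner entry, and [y'] commutes with all elements supported at
     [n]. *)
  move=> x; rewrite -(conjgKV g x) -Eg /commute -!fM; congr (f _ m).
  apply/funext => j; set x' := x ^ _.
  change (y' j * single n x' j = single n x' j * y' j).
  by rewrite /y' /single; case: ifP; rewrite mulg1 mul1g.
(* A column of trivial entries would put [single n a] in the kernel of [f]. *)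
have col n : exists m g, forall x, E m n x = x ^ g.
  apply: contra_notP a1 => noE; rewrite -(single_id _ _ n a).
  suff -> : single n a = 1 by [].
  apply: (can_inj fK); rewrite fH.1; apply/funext => m.
  case: (endL _ (EH m n)) => [[g Eg]|E1].
    by case: noE; exists m, g.
  by rewrite -/(E m n a) E1.
have [t tP] := choice col.
(* Otherwise every [t n] differs from [m]. Row [t n] recovers [z n] up to conjugation from a
   coordinate where [single m a] is 1, so [z] is 1. *)
have row m : exists n g, forall y, f y m = y n ^ g.
  apply: contra_notP a1 => noE; pose z := f' (single m a).
  rewrite -(single_id _ _ m a) -[single m a]f'K -/z.
  suff -> : z = 1 by rewrite fH.1.
  apply/funext => n; have [g Eg] := tP n.
  have zE := rowE _ _ _ Eg z; rewrite f'K single_neq in zE.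
    by apply/eqP; rewrite -(conjg_eq1 _ g) -zE.
  by apply/eqP => tm; case: noE; exists n, g; apply: rowE; rewrite -tm.
have [s sP] := choice row.
have [g gP] := choice sP.
(* Two rows reading the same coordinate cannot separate [m] from [m'] on the preimage of
   [single m a]. *)
have s_inj : injective s.
  move=> m m' ss; apply/eqP; apply: contra_notT a1 => mm'.
  pose z := f' (single m a).
  have := gP m' z; rewrite f'K single_neq 1?eq_sym // -ss => z1.
  have := gP m z; rewrite f'K single_id => ->.
  by move/esym/eqP: z1; rewrite conjg_eq1 => /eqP ->; rewrite conj1g.
(* Row [t n] does not kill [single n a], so the coordinate it reads is [n]. *)
have tK : cancel t s.
  move=> n; have [h Eh] := tP n; apply/eqP.
  apply: contra_notT (conj_neq1 h) => stn.
  by rewrite -Eh /E gP single_neq // conj1g.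
have sK : cancel s t by move=> m; apply: s_inj; rewrite tK.
by exists (Symm sK tK), g.
Qed.

(** * Isomorphisms and centers of powers *)

(** Interleave: the first factor fills the even coordinates, the second the odd ones. *)
Lemma pow_natD_isomorphic (L : groupType) :
  isomorphic ((nat -> L) * (nat -> L))%type (nat -> L).
Proof.
pose f (u : (nat -> L) * (nat -> L)) : nat -> L :=
  fun n => if odd n then u.2 n./2 else u.1 n./2.
pose f' (y : nat -> L) : (nat -> L) * (nat -> L) :=
  (fun n => y n.*2, fun n => y n.*2.+1).
exists f; split.
  split=> [|u v]; apply/funext => n; rewrite /f; first by case: ifP.
  change ((if odd n then u.2 n./2 * v.2 n./2 else u.1 n./2 * v.1 n./2)
          = f u n * f v n).
  by rewrite /f; case: ifP.
exists f' => [[u v]|y]; rewrite /f /f' /=.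
  by congr pair; apply/funext => n /=; rewrite odd_double ?doubleK // uphalf_double.
apply/funext => n; case: ifP => n_odd; rewrite -[in RHS](odd_double_half n) n_odd //.
Qed.

Lemma isomorphic_trans (A B C : groupType) :
  isomorphic A B -> isomorphic B C -> isomorphic A C.
Proof.
move=> [f [fH fb]] [g [gH gb]]; exists (g \o f); split; last exact: bij_comp.
by split=> [|x y] /=; rewrite ?fH.1 ?gH.1 // fH.2 gH.2.
Qed.

Lemma isomorphic_sym (A B : groupType) : isomorphic A B -> isomorphic B A.
Proof.
move=> [f [fH [g fK gK]]]; exists g; split; last by exists f.
exact: Hom_can fK gK.
Qed.

Lemma isomorphic_prod (A B C D : groupType) :
  isomorphic A B -> isomorphic C D -> isomorphic (A * C)%type (B * D)%type.
Proof.
move=> [f [fH [f' fK f'K]]] [g [gH [g' gK g'K]]].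
exists (fun u => (f u.1, g u.2)); split.
  by split=> [|u v] /=; rewrite ?fH.1 ?gH.1 // fH.2 gH.2.
by exists (fun u => (f' u.1, g' u.2)) => -[u v] /=;
   rewrite ?fK ?gK ?f'K ?g'K.
Qed.

Lemma center_pow (I : eqType) (L : groupType) :
  center L = [set 1] -> center (I -> L) = [set 1].
Proof.
move=> Z1; apply/seteqP; split=> [z zC|_ ->].
  apply/funext => i; suff: center L (z i) by rewrite Z1.
  move=> x; have := congr1 (@^~ i) (zC (single i x)).
  change (z i * single i x i = single i x i * z i -> commute (z i) x).
  by rewrite single_id.
by move=> x; rewrite /commute mulg1 mul1g.
Qed.

Lemma center_isomorphic (A B : groupType) :
  isomorphic A B -> center B = [set 1] -> center A = [set 1].
Proof.
move=> [f [fH [g fK gK]]] Z1; apply/seteqP; split=> [z zC|_ ->]; last first.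
  by move=> x; rewrite /commute mulg1 mul1g.
apply: (can_inj fK); rewrite fH.1.
suff: center B (f z) by rewrite Z1.
by move=> y; rewrite -(gK y) /commute -!fH.2 zC.
Qed.

(** * The coordinate permutation of an automorphism of a rigid power *)

Section RigidPower.
Variables (L G : groupType) (phi : G -> nat -> L) (psi : (nat -> L) -> G).
Hypotheses (Lrigid : rigid L) (phiH : Hom G (nat -> L) phi).
Hypotheses (phiK : cancel phi psi) (psiK : cancel psi phi).

Let psiH : Hom (nat -> L) G psi := Hom_can _ _ _ _ phiH phiK psiK.

Lemma rigid_neq1 : exists a : L, a <> 1.
Proof. by case: Lrigid. Qed.

Lemma phi_inj (x y : G) : (forall n, phi x n = phi y n) -> x = y.
Proof. by move=> /funext; exact: can_inj. Qed.

Lemma phiM (x y : G) n : phi (x * y) n = phi x n * phi y n.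
Proof. by rewrite phiH.2. Qed.

Lemma phiJ (x y : G) n : phi (x ^ y) n = phi x n ^ phi y n.
Proof. by rewrite (HomJ _ _ _ _ _ phiH). Qed.

Lemma center_rigid_power : center G = [set 1].
Proof.
have [_ [Z1 _] _ _] := Lrigid.
apply: (center_isomorphic _ (nat -> L)); last exact: center_pow.
by exists phi; split => //; exists psi.
Qed.

(** Records the class of [a] modulo inner automorphisms: the conjugators [g] are left
    unspecified. *)
Definition twists (a : G -> G) (s : symm nat) :=
  exists g : nat -> L, forall x n, phi (a x) n = phi x (s n) ^ g n.

Lemma Aut_twists (a : G -> G) : Hom G G a -> bijective a -> exists s, twists a s.
Proof.
move=> aH [a' aK a'K].
have [[c c1] [Z1 _] _ endL] := Lrigid.
have [|||s [g sg]] :=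
  power_automorphism_coords nat L (phi \o a \o psi) c c1 Z1.
- move=> h hH; have: Hom L L h by [].
  rewrite endL => -[[b [g gb] <-]|->]; last by right.
  by left; exists g.
- split=> [|x y] /=; first by rewrite psiH.1 aH.1 phiH.1.
  by rewrite psiH.2 aH.2 phiH.2.
- exists (phi \o a' \o psi) => x /=; first by rewrite phiK aK psiK.
  by rewrite phiK a'K psiK.
by exists s, g => x n; rewrite -sg /= phiK.
Qed.

Lemma twists_uniq (a : G -> G) s t : twists a s -> twists a t -> s = t.
Proof.
move=> [g ga] [h ha]; have [c c1] := rigid_neq1.
apply/symmP/(coord_map_uniq _ _ c _ _ g h c1) => y m.
by rewrite -[y]psiK -ga -ha.
Qed.

(** The order reverses because [a] reads coordinate [s n] of [b x], which reads coordinate [t (s n)]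
    of [x]. *)
Lemma twists_comp (a b : G -> G) s t :
  twists a s -> twists b t -> twists (a \o b) (t * s).
Proof.
move=> [g ga] [h ha]; exists (fun n => h (s n) * g n) => x n.
by rewrite /= ga ha conjgM.
Qed.

Lemma twists_conj (g : G) : twists (conjg^~ g) 1.
Proof. by exists (phi g) => x n; rewrite phiJ. Qed.

Lemma permutes_twists (a : symm G) s : permutes_coords phi a s -> twists a s.
Proof. by move=> sa; exists 1 => x n; rewrite sa conjg1. Qed.

(** As the power is unrestricted, any family of coordinatewise conjugators is an element of [G]. *)
Lemma twists1_inner (a : G -> G) :
  twists a 1 -> exists g, forall x, a x = x ^ g.
Proof.
move=> [g ga]; exists (psi g) => x; apply: phi_inj => n.
by rewrite ga phiJ psiK.
Qed.

(** * The copy of $S_\omega$ in the automorphism group *)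

Lemma coord_permK (s t : symm nat) : cancel s t ->
  cancel (fun x => psi (fun n => phi x (t n))) (fun x => psi (fun n => phi x (s n))).
Proof. by move=> st x; apply: phi_inj => n; rewrite !psiK st. Qed.

Definition coord_perm (s : symm nat) : symm G :=
  Symm (coord_permK s s^-1 (symm_funK s)) (coord_permK s^-1 s (symm_invK s)).

Lemma coord_permE s : permutes_coords phi (coord_perm s) s^-1.
Proof. by move=> x n; rewrite /= psiK. Qed.

Lemma permutes_coords_uniq (a b : symm G) s :
  permutes_coords phi a s -> permutes_coords phi b s -> a = b.
Proof.
by move=> sa sb; apply: symmP => x; apply: phi_inj => n; rewrite sa sb.
Qed.

Lemma coord_permP (a : symm G) s :
  permutes_coords phi a s -> a = coord_perm s^-1.
Proof.
move=> sa; apply: (permutes_coords_uniq _ _ s) => //.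
by rewrite -[s in permutes_coords _ _ s]invgK; exact: coord_permE.
Qed.

Lemma coord_perm_Hom : Hom (symm nat) (symm G) coord_perm.
Proof.
split=> [|s t]; apply: symmP => x; apply: phi_inj => n.
  by rewrite /= psiK.
change (phi (coord_perm (s * t) x) n = phi (coord_perm s (coord_perm t x)) n).
by rewrite !coord_permE.
Qed.

Lemma coord_perm_inj : injective coord_perm.
Proof.
move=> s t st; apply: invg_inj; apply: (twists_uniq (coord_perm s)).
  exact/permutes_twists/coord_permE.
by rewrite st; exact/permutes_twists/coord_permE.
Qed.

Lemma range_coord_perm : range coord_perm = coord_perms phi.
Proof.
apply/seteqP; split=> [_ [s _ <-]|a [s sa]].
  by exists s^-1; exact: coord_permE.
by exists s^-1 => //; exact/esym/coord_permP.
Qed.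

Lemma coord_perms_Aut : coord_perms phi `<=` Aut G.
Proof.
move=> a [s sa]; split=> [|x y]; apply: phi_inj => n.
  by rewrite sa phiH.1.
by rewrite sa !phiM !sa.
Qed.

Lemma semidirect_Aut : semidirect (Inn G) (coord_perms phi) (Aut G).
Proof.
have [_ Inn_Aut _] := Inn_normal G.
split; [exact: Aut_subgroup | exact: Inn_normal | | |].
- rewrite -range_coord_perm; exact/subgroup_range/coord_perm_Hom.
- apply/seteqP; split=> [a [[g ga] [s sa]]|_ ->]; last first.
    by split; [exists 1 => x; rewrite conjg1 | exists 1].
  have s1 : s = 1.
    apply: (twists_uniq a); first exact: permutes_twists.
    have -> : symm_fun a = conjg^~ g by apply/funext.
    exact: twists_conj.
  by apply: symmP => x; apply: phi_inj => n; rewrite sa s1.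
- apply/seteqP; split=> [_ [a aI [b bP <-]]|a aH].
    by apply: subgroupM; [exact: Aut_subgroup | exact: Inn_Aut
                         | exact: coord_perms_Aut].
  have [s sa] := Aut_twists a aH (Bijective (symm_funK a) (symm_invK a)).
  pose b := coord_perm s^-1.
  have bP : permutes_coords phi b s by rewrite -[s]invgK; exact: coord_permE.
  have bVP : permutes_coords phi b^-1 s^-1.
    by move=> x n; rewrite -[x in RHS](symm_invK b) bP symm_invK.
  (* Dividing by the coordinate permutation with the same [s] leaves the permutation 1, hence an
     inner factor. *)
  exists (a * b^-1); last by exists b; [exists s | rewrite mulgVK].
  apply: twists1_inner; rewrite -(mulVg s).
  by apply: twists_comp => //; exact: permutes_twists.
Qed.

(** * Extensions of a rigid power by itself *)

Lemma splitter_rigid_power : splitter G.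
Proof.
apply: splitter_of_inner_extensions; first exact: center_rigid_power.
move=> H i p ex; have [iH pH i_inj p_surj ker] := ex.
(* [k] is the right action of [H] on [G] by conjugation. *)
have [k kP] : {k : H -> G -> G & forall h x, i (k h x) = i x ^ h}.
  apply: (choice (P := fun h f => forall x, i (f x) = i x ^ h)) => h.
  by have [k kP] := choice (conj_normal_sub _ _ _ _ _ ex h); exists k.
have kM h h' : k (h * h') = k h' \o k h.
  by apply/funext => x; apply: i_inj; rewrite /= !kP conjgM.
have k1 : k 1 = id by apply/funext => x; apply: i_inj; rewrite kP conjg1.
have ki g : k (i g) = conjg^~ g.
  by apply/funext => x; apply: i_inj; rewrite kP (HomJ _ _ _ _ _ iH).
have kAut h : Hom G G (k h).
  split=> [|x y]; apply: i_inj; first by rewrite kP iH.1 conj1g.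
  by rewrite iH.2 !kP iH.2 conjMg.
have kbij h : bijective (k h).
  exists (k h^-1) => x.
    by have := congr1 (@^~ x) (kM h h^-1); rewrite mulgV k1.
  by have := congr1 (@^~ x) (kM h^-1 h); rewrite mulVg k1.
have [s sP] := choice (fun h => Aut_twists (k h) (kAut h) (kbij h)).
(* The reversals in [kM] and [twists_comp] cancel. *)
have sM h h' : s (h * h') = s h * s h'.
  apply: (twists_uniq (k (h * h'))) => //.
  by rewrite kM; exact: twists_comp.
have si g : s (i g) = 1.
  by apply: (twists_uniq (k (i g))) => //; rewrite ki; exact: twists_conj.
have s_p h h' : p h = p h' -> s h = s h'.
  move=> pE; have [g _ gE] : range i (h / h').
    by rewrite ker /= pH.2 (HomV _ _ _ _ pH) pE mulgV.
  by rewrite -(mulgVK h' h) -gE sM si mul1g.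
(* A set-theoretic section suffices: by [s_p], [s] depends only on the image under [p], so [s \o q]
   is multiplicative. *)
have [q qK] : {q : G -> H & forall x, p (q x) = x}.
  apply: (choice (P := fun x h => p h = x)) => x; have [h _ <-] : range p x by rewrite p_surj.
  by exists h.
have s1 h : s h = 1.
  have [_ _ S_triv _] := Lrigid.
  have: Hom (nat -> L) (symm nat) (s \o q \o psi).
    split=> [|x y] /=; last first.
      by rewrite -sM; apply: s_p; rewrite pH.2 !qK psiH.2.
    by rewrite -(si 1); apply: s_p; rewrite qK psiH.1 iH.1 pH.1.
  rewrite S_triv => /(congr1 (@^~ (phi (p h)))); apply: etrans => /=.
  by apply: s_p; rewrite qK phiK.
move=> h; have := sP h; rewrite s1 => /twists1_inner[g gP].
by exists g => x; rewrite -kP gP (HomJ _ _ _ _ _ iH).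
Qed.

End RigidPower.

(* Under composition of maps, s |-> ((x_n) |-> (x_(s n))) reverses products,   *)
(* hence the s^-1 in the embedding of S_omega below.                          *)
Theorem theorem1p4 (L G : groupType) (phi : G -> (nat -> L)) :
  rigid L -> isomorphism phi ->
  [/\ semidirect (Inn G) (coord_perms phi) (Aut G) /\
      (exists theta : symm nat -> symm G,
         [/\ Hom (symm nat) (symm G) theta, injective theta,
             range theta = coord_perms phi
           & forall s, permutes_coords phi (theta s) s^-1]),
      splitter G
    & isomorphic (G * G)%type G].
Proof.
move=> Lrigid phi_iso; have [phiH [psi phiK psiK]] := phi_iso.
split.
- split; first exact: semidirect_Aut phiK psiK.
  exists (coord_perm L G phi psi phiK psiK); split.
  + exact: coord_perm_Hom.
  + exact: coord_perm_inj.
  + exact: range_coord_perm.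
  + exact: coord_permE.
- exact: splitter_rigid_power phiK psiK.
- have GP : isomorphic G (nat -> L) by exists phi.
  apply: isomorphic_trans (isomorphic_prod _ _ _ _ GP GP) _.
  apply: isomorphic_trans (pow_natD_isomorphic L) _.
  exact: isomorphic_sym.
Qed.
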